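(* Suppose that $J:\mathcal{P}(\mathcal{X})\to\mathbb{R}$ is convex and $L$-smooth, and let $J^*=\inf_{\mu\in\mathcal{P}(\mathcal{X})}J(\mu)$ (attained) and $R=\sup\{\|\mu_1-\mu_2\|:\mu_1,\mu_2\in\mathcal{P}(\mathcal{X})\}$. Suppose that there exists $c_0<\infty$ such that for all $\mu\in\mathcal{P}(\mathcal{X})$ (and all sample sizes $m\ge1$) $$\mathbb{E}\left[\sqrt m\,\|H_{\mu,m}-h_\mu\|_\infty\right]\le c_0.$$ Let $\{\mu_k\}$ be generated, from $\mu_0\in\mathcal{P}(\mathcal{X})$, by the stochastic Frank-Wolfe recursion $$\mu_{k+1}=(1-\eta_k)\mu_k+\eta_k\,\delta_{\hat x_{k+1}(m_{k+1})},\qquad \hat x_{k+1}(m_{k+1})\in\arg\min_{x\in\mathcal{X}}H_{\mu_k,m_{k+1}}(x),\qquad k\ge0,$$ with $$\eta_k=\frac{2}{k+2},\qquad m_k\ge\left(\frac{c_0(k+2)}{LR}\right)^2.$$ Then, for every $0<\delta<1$, $$k^{1-\delta}\,(J(\mu_k)-J^* )\to0\quad\text{almost surely as }k\to\infty.$$ Moreover, if the minimizer $\mu^*:=\arg\inf_{\mu\in\mathcal{P}(\mathcal{X})}J(\mu)$ is unique in the weak topology, then the sequence $(\mu_k)_{k\ge1}$ converges to $\mu^*$ almost surely in the weak topology.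
   Context: $\mathcal{X}$ is a nonempty compact subset of $\mathbb{R}^d$ with Borel $\sigma$-algebra $\mathcal{B}(\mathcal{X})$, $\mathcal{P}(\mathcal{X})$ is the set of Borel probability measures on $\mathcal{X}$, and $\delta_x$ is the Dirac measure at $x$. The functional $J$ is convex if $J((1-t)\mu+t\nu)\le(1-t)J(\mu)+tJ(\nu)$ for all $\mu,\nu\in\mathcal{P}(\mathcal{X})$, $t\in[0,1]$. The weak topology on $\mathcal{P}(\mathcal{X})$ is the topology of weak convergence of probability measures. The influence function of $J$ at $\mu$ is $h_\mu(x)=\lim_{t\to0^+}\frac1t\{J(\mu+t(\delta_x-\mu))-J(\mu)\}$, $x\in\mathcal{X}$. The von Mises derivative of $J$ at $\mu$ is $J'_\mu(\nu)=\lim_{t\to0^+}\frac1t\{J(\mu+t(\nu-\mu))-J(\mu)\}$; it exists at $\mu$ if these limits exist for all $\nu\in\mathcal{P}(\mathcal{X})$ and there is a measurable $\phi_\mu:\mathcal{X}\to\mathbb{R}$, integrable with respect to every $\nu\in\mathcal{P}(\mathcal{X})$, with $J'_\mu(\nu)=\int\phi_\mu\,\mathrm{d}(\nu-\mu)$. Then $h_\mu=\phi_\mu-\int\phi_\mu\,\mathrm{d}\mu$ and $J'_\mu(\nu)=\int h_\mu\,\mathrm{d}\nu$. Total variation distance: $\|\mu_1-\mu_2\|:=\sup_{A\in\mathcal{B}(\mathcal{X})}|\mu_1(A)-\mu_2(A)|$. $J$ is $L$-smooth ($L>0$) if $\sup_{x\in\mathcal{X}}|h_{\mu_1}(x)-h_{\mu_2}(x)|\le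 L\|\mu_1-\mu_2\|$ for all $\mu_1,\mu_2\in\mathcal{P}(\mathcal{X})$. Stochastic oracle: $Y$ is a random element of a measurable space, $H_\mu(\cdot,Y):\mathcal{X}\to\mathbb{R}$ is a random function with $\mathbb{E}[H_\mu(x,Y)]=h_\mu(x)$ for all $\mu,x$, and $H_{\mu,m}(x)=\frac1m\sum_{j=1}^m H_\mu(x,Y_j)$ with $Y_1,\dots,Y_m$ i.i.d. copies of $Y$; $\|g\|_\infty=\sup_{x\in\mathcal{X}}|g(x)|$. At iteration $k$, $H_{\mu_k,m_{k+1}}$ is formed from $m_{k+1}$ fresh i.i.d. copies of $Y$, independent of the samples used to construct $\mu_0,\dots,\mu_k$. Standing assumptions: the von Mises derivative of $J$ exists at every $\mu\in\mathcal{P}(\mathcal{X})$, each $H_{\mu_k,m_{k+1}}$ attains its minimum on $\mathcal{X}$, $R>0$, and all random quantities are measurable.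
   Formalization: ''Unique in the weak topology'' is taken to mean that every weak limit of a minimizing sequence of J equals μ* (ordinary uniqueness if J is weakly lower semicontinuous; otherwise the claim can fail); the oracle error is assumed jointly measurable in μ and the samples. *)

(* Defs.v *)
From HB Require Import structures.
From mathcomp Require Import all_boot all_order all_algebra.
From mathcomp Require Import all_classical all_reals all_analysis.
From mathcomp Require Import measurable_realfun.

Set Implicit Arguments.
Unset Strict Implicit.
Unset Printing Implicit Defensive.
Import Order.TTheory GRing.Theory Num.Theory.
Import numFieldNormedType.Exports.

Local Open Scope classical_set_scope.
Local Open Scope ring_scope.

(* A nonempty X in R^d as a space of its own: the subspace topology and the
   sigma-algebra generated by its open sets. The proof X0 only serves to exhibit
   the base point that measurable types carry. *)
Section domain.
Context {R : realType} {d : nat} {X : set 'rV[R]_d}.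

Definition domain (X0 : X !=set0) : Type := set_type X.

Variable X0 : X !=set0.

HB.instance Definition _ := Topological.copy (domain X0) (set_type X).

Definition domain_point : domain X0 :=
  exist _ (projT1 (cid X0)) (mem_set (projT2 (cid X0))).

HB.instance Definition _ := isPointed.Build (domain X0) domain_point.
HB.instance Definition _ := Measurable.copy (domain X0)
  (g_sigma_algebraType (@open (domain X0))).

(* Borel probability measures on X. As a measurable type this carries the
   sigma-algebra generated by the evaluations mu |-> mu A, which for compact X
   is the Borel sigma-algebra of the weak topology. *)
Definition prob := pprobability (domain X0) R.

End domain.

Section mixture.
Context {disp : measure_display} {T : measurableType disp} {R : realType}.
Variables (t : R) (mu nu : probability T R).

(* (1 - t) mu + t nu; outside of 0 <= t <= 1, where this need not be a
   probability measure, the value is mu by convention. *)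
Definition mixture (A : set T) : \bar R :=
  if 0 <= t <= 1 then ((1 - t)%:E * mu A + t%:E * nu A)%E else mu A.

Let mixture0 : mixture set0 = 0%E.
Proof. by rewrite /mixture !measure0 !mule0 adde0 if_same. Qed.

Let mixture_ge0 A : (0 <= mixture A)%E.
Proof.
rewrite /mixture; case: ifPn => // /andP[t0 t1].
by rewrite adde_ge0// mule_ge0// lee_fin// subr_ge0.
Qed.

Let mixture_sigma_additive : semi_sigma_additive mixture.
Proof.
move=> F mF tF mUF; rewrite /mixture; case: ifPn => [/andP[t0 t1]|_]; last first.
  exact: measure_semi_sigma_additive.
have t1' : 0 <= 1 - t by rewrite subr_ge0.
pose a : {nonneg R} := NngNum t1'; pose b : {nonneg R} := NngNum t0.
pose m := measure_add (mscale a mu) (mscale b nu).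
have mE A : m A = ((1 - t)%:E * mu A + t%:E * nu A)%E.
  by rewrite /m measure_addE.
rewrite -mE; under eq_fun do under eq_bigr do rewrite -mE.
exact: measure_semi_sigma_additive.
Qed.

HB.instance Definition _ := isMeasure.Build _ _ _ mixture
  mixture0 mixture_ge0 mixture_sigma_additive.

Let mixture_setT : mixture setT = 1%E.
Proof.
rewrite /mixture; case: ifPn => _; rewrite !probability_setT// !mule1.
by rewrite -EFinD subrK.
Qed.

HB.instance Definition _ :=
  Measure_isProbability.Build _ _ _ mixture mixture_setT.

End mixture.

Section functionals.
Context {R : realType} {d : nat} {X : set 'rV[R]_d} {X0 : X !=set0}.
Local Notation PX := (prob X0).
Implicit Types (J : PX -> R) (mu nu : PX) (x : domain X0).

Definition convex_functional J : Prop := forall mu nu (t : R), 0 <= t <= 1 ->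
  J (mixture t mu nu) <= (1 - t) * J mu + t * J nu.

Definition diff_quotient J mu nu (t : R) : R :=
  t^-1 * (J (mixture t mu nu) - J mu).

Definition vonMises J mu nu : R := lim (diff_quotient J mu nu @ 0^'+).

Definition influence J mu x : R := lim (diff_quotient J mu (\d_x) @ 0^'+).

Definition vonMises_exists J mu : Prop :=
  (forall nu, cvg (diff_quotient J mu nu @ 0^'+)) /\
  exists phi : domain X0 -> R,
    [/\ measurable_fun setT phi,
        forall nu : probability (domain X0) R,
          nu.-integrable setT (EFin \o phi) &
        forall nu : probability (domain X0) R,
          vonMises J mu nu =
          (\int[nu]_y phi y) - (\int[(mu : probability _ R)]_y phi y)].

Definition TV (mu nu : probability (domain X0) R) : R :=
  sup [set `|fine (mu A) - fine (nu A)| | A in measurable].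

(* Extended-real valued, so that an unbounded g has norm +oo. *)
Definition sup_norm (g : domain X0 -> R) : \bar R :=
  ereal_sup [set (`|g x|)%:E | x in setT].

Definition smooth_functional (L : R) J : Prop := forall mu nu,
  (sup_norm (fun x => influence J mu x - influence J nu x)%R
     <= (L * TV mu nu)%:E)%E.

Definition is_minimizer J mu : Prop := forall nu, J mu <= J nu.

Definition weak_cvg (mu_ : nat -> PX) (mu : PX) : Prop :=
  forall f : domain X0 -> R, continuous f -> (exists M, forall x, `|f x| <= M) ->
    (\int[(mu_ n : probability _ R)]_x f x) @[n --> \oo] -->
      (\int[(mu : probability _ R)]_x f x).

(* arg inf in the weak topology: the weak limits of minimizing sequences. It
   contains every minimizer, and nothing else when J is weakly lower
   semicontinuous. Smoothness only gives continuity in total variation, so in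
   general it can be larger: on [0, 1], take J mu = \int phi dmu with phi 0 = 1,
   phi 1 = 0 and phi x = x in between; the only minimizer is \d_1, but \d_(1/n)
   is a minimizing sequence with weak limit \d_0. *)
Definition weak_arginf J : set PX :=
  [set nu | exists2 nu_ : nat -> PX,
     J (nu_ n) @[n --> \oo] --> inf (range J) & weak_cvg nu_ nu].

End functionals.

Arguments TV {R d X} X0 mu nu.

Definition TV_diameter {R : realType} {d : nat} {X : set 'rV[R]_d}
    (X0 : X !=set0) : R :=
  sup [set TV X0 mu nu | mu in setT & nu in setT].

Section independence.
Context {disp : measure_display} {Omega : measurableType disp} {R : realType}.
Variable P : probability Omega R.

Definition independent_systems (I : finType) (F : I -> set_system Omega) : Prop :=
  forall (K : {set I}) (A : I -> set Omega),
    (forall i, i \in K -> F i (A i)) ->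
    P (\bigcap_(i in [set` K]) A i) = (\prod_(i in K) P (A i))%E.

Context {dispE : measure_display} {E : measurableType dispE}.

Definition generated (Z : Omega -> E) : set_system Omega :=
  preimage_set_system setT Z measurable.

Definition copy_of (Y Z : Omega -> E) : Prop :=
  forall B, measurable B -> P (Z @^-1` B) = P (Y @^-1` B).

Definition iid_copies (Y : Omega -> E) (m : nat) (Z : 'I_m -> Omega -> E) : Prop :=
  [/\ forall j, measurable_fun setT (Z j),
      forall j, copy_of Y (Z j) &
      independent_systems (fun j => generated (Z j))].

End independence.

Section oracle.
Context {R : realType} {d : nat} {X : set 'rV[R]_d} {X0 : X !=set0}.
Context {dispE : measure_display} {E : measurableType dispE}.
Local Notation PX := (prob X0).
Variable H : PX -> domain X0 -> E -> R.

Definition oracle_mean (mu : PX) (m : nat) (y : m.-tuple E) (x : domain X0) : R :=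
  m%:R^-1 * \sum_(j < m) H mu x (tnth y j).

Definition oracle_error (J : PX -> R) (m : nat) (z : PX * m.-tuple E) : \bar R :=
  sup_norm (fun x => oracle_mean z.1 z.2 x - influence J z.1 x).

Context {dispO : measure_display} {Omega : measurableType dispO}.
Variable P : probability Omega R.

Definition oracle_rate (J : PX -> R) (Y : Omega -> E) (c0 : R) : Prop :=
  forall (mu : PX) (m : nat) (Z : 'I_m -> Omega -> E), (0 < m)%N ->
    iid_copies P Y Z ->
    (\int[P]_w ((Num.sqrt (m%:R : R))%:E
                * oracle_error J (mu, [tuple Z j w | j < m]))
      <= c0%:E)%E.

(* Sigma-algebra of the samples Ys i j (j < m i) and of the selected points
   xhat i over the iterations 1 <= i <= k. The points are listed because an
   argmin need not be selected as a function of the samples alone. *)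
Definition history (m : nat -> nat) (Ys : nat -> nat -> Omega -> E)
    (xhat : nat -> Omega -> domain X0) (k : nat) : set_system Omega :=
  <<s [set A | exists2 i, (1 <= i <= k)%N &
         (exists2 j, (j < m i)%N & generated (Ys i j) A)
         \/ generated (xhat i) A ] >>.

(* None stands for the past, Some j for the j-th sample of iteration k.+1. *)
Definition past_or_fresh (m : nat -> nat) (Ys : nat -> nat -> Omega -> E)
    (xhat : nat -> Omega -> domain X0) (k : nat)
    (o : option 'I_(m k.+1)) : set_system Omega :=
  if o is Some j then generated (Ys k.+1 j) else history m Ys xhat k.

Definition fresh_samples (m : nat -> nat) (Y : Omega -> E)
    (Ys : nat -> nat -> Omega -> E) (xhat : nat -> Omega -> domain X0) : Prop :=
  forall k, (forall j : 'I_(m k.+1), copy_of P Y (Ys k.+1 j)) /\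
    independent_systems P (@past_or_fresh m Ys xhat k).

End oracle.

Definition step {R : realType} (k : nat) : R := 2 / (k%:R + 2).

(* Main.v *)
Require Import Defs.
From HB Require Import structures.
From mathcomp Require Import all_boot all_order all_algebra.
From mathcomp Require Import all_classical all_reals all_analysis.
From mathcomp Require Import measurable_realfun ring lra.
Import Order.TTheory GRing.Theory Num.Theory.
Import numFieldNormedType.Exports.
Local Open Scope classical_set_scope.
Local Open Scope ring_scope.

(** Write r_k = J(mu_k) - J^* and eps_k for the sup-norm error of the oracle
    at step k.  Convexity (used at the end point of the step) and L-smoothness
    give
      r_{k+1} <= (1 - eta_k) r_k + 2 eta_k eps_k + 2 L eta_k^2.
    Multiplying by (k+1)(k+2) makes this telescope, so k(k+1) r_k is at most
    the sum over j < k of (j+1)(j+2) e_j, where e_j is the error term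
    2 eta_j eps_j + 2 L eta_j^2.  The fresh samples are independent of mu_k,
    hence E[eps_k] = O(1/k) by Fubini and the sum of j^{1 - delta/2} e_j has
    finite expectation.  It is therefore almost surely finite, which yields
    r_k = O(k^{-1 + delta/2}) without conditional expectations.

    For the weak convergence, P(X) is weakly sequentially compact: code the
    points of X by their memberships in a countable basis, extract a cluster
    point of the masses of the finite-depth cells, realise these masses by
    nested subintervals of [0, 1[, and transport the Lebesgue measure along the
    map sending u to a limit of points of the cells on its branch.  A
    subsequence of (mu_k) staying away from mu^* would then have another weak
    limit in the arg inf. *)

Set Implicit Arguments.
Unset Strict Implicit.
Unset Printing Implicit Defensive.

(** * Integrals against probability measures *)

Lemma probability_Rintegral_cst {R : realType} {disp : measure_display}
    {T : measurableType disp} (P : probability T R) (c : R) :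
  \int[P]_x c = c.
Proof. by rewrite Rintegral_cst//= probability_setT mulr1. Qed.

Lemma ge0_integral_mixture {R : realType} {disp : measure_display}
    {T : measurableType disp} (t : R)
    (mu nu : probability T R) (f : T -> \bar R) : 0 <= t <= 1 ->
  measurable_fun setT f -> (forall x, 0 <= f x)%E ->
  (\int[mixture t mu nu]_x f x =
   (1 - t)%:E * \int[mu]_x f x + t%:E * \int[nu]_x f x)%E.
Proof.
move=> t01 mf f0; have /andP[t0 t1] := t01.
have t1' : 0 <= 1 - t by rewrite subr_ge0.
pose a : {nonneg R} := NngNum t1'; pose b : {nonneg R} := NngNum t0.
pose m := measure_add (mscale a mu) (mscale b nu).
have mE A : m A = ((1 - t)%:E * mu A + t%:E * nu A)%E.
  by rewrite /m measure_addE.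
rewrite (eq_measure_integral m); last first.
  by move=> A mA _; transitivity (m A) => //; rewrite mE /= /mixture t01.
by rewrite ge0_integral_measure_add// !ge0_integral_mscale.
Qed.

(** Integrability under every probability measure makes the integrals of the positive and negative
    parts finite, so the nonnegative case applies to each part and the results can be subtracted. *)
Lemma Rintegral_mixture {R : realType} {disp : measure_display}
    {T : measurableType disp} (t : R)
    (mu nu : probability T R) (f : T -> R) : 0 <= t <= 1 ->
  (forall P : probability T R, P.-integrable setT (EFin \o f)) ->
  \int[mixture t mu nu]_x f x = (1 - t) * \int[mu]_x f x + t * \int[nu]_x f x.
Proof.
move=> t01 intf; rewrite /Rintegral.
have mf : measurable_fun setT (EFin \o f) := measurable_int _ (intf mu).
have fin P : (\int[P : probability T R]_x (EFin \o f)^\+ x)%E \is a fin_num /\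
    (\int[P]_x (EFin \o f)^\- x)%E \is a fin_num.
  have := intf P => /[dup] /integrable_funepos ip /integrable_funeneg im.
  by split; apply: integrable_fin_num => //; [exact: ip|exact: im].
have mp := measurable_funepos mf; have mn := measurable_funeneg mf.
have [fp fm] := fin mu; have [gp gm] := fin nu.
have E (Q : probability T R) : (\int[Q]_x (f x)%:E =
    \int[Q]_x (EFin \o f)^\+ x - \int[Q]_x (EFin \o f)^\- x)%E.
  exact: integralE.
rewrite (E (mixture t mu nu)) (E mu) (E nu) !(ge0_integral_mixture _ _ t01) //.
move: fp fm gp gm; do 4! [move: (integral _ _ _)]; move=> a b c e.
by do 4! move=> /fineK <-; rewrite -!EFinM -!EFinN -!EFinD /=; ring.
Qed.

Lemma Rintegral_finite_range {R : realType} {disp : measure_display}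
    {T : measurableType disp} (P : probability T R) (I : finType)
    (S : T -> I) (g : I -> R) :
  (forall i, measurable (S @^-1` [set i])) ->
  P.-integrable setT (EFin \o (g \o S)) /\
  \int[P]_x g (S x) = \sum_i g i * fine (P (S @^-1` [set i])).
Proof.
move=> mS.
have gE : g \o S = fun x => \sum_i g i * \1_(S @^-1` [set i]) x.
  apply/funext => x /=; rewrite (bigD1 (S x))//= big1 ?addr0.
    by rewrite indicE mem_set// mulr1.
  by move=> i iS; rewrite indicE memNset ?mulr0//= => /eqP; rewrite eq_sym (negbTE iS).
have mi i : P.-integrable setT (EFin \o (fun x => g i * \1_(S @^-1` [set i]) x)).
  apply: (integrableZl measurableT (g i)
    (f := fun x => (\1_(S @^-1` [set i]) x)%:E)).
  exact: integrable_indic.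
have H (s : seq I) : P.-integrable setT
      (EFin \o (fun x => \sum_(i <- s) g i * \1_(S @^-1` [set i]) x)) /\
    \int[P]_x (\sum_(i <- s) g i * \1_(S @^-1` [set i]) x) =
      \sum_(i <- s) g i * fine (P (S @^-1` [set i])).
  elim: s => [|i s [IHi IHe]].
    under eq_Rintegral do rewrite big_nil.
    rewrite big_nil Rintegral_cst// mul0r; split => //.
    under eq_fun do rewrite big_nil; exact: finite_measure_integrable_cst.
  under eq_Rintegral do rewrite big_cons.
  rewrite big_cons RintegralD//; split.
    under eq_fun do rewrite big_cons.
    exact: (integrableD measurableT (mi i) IHi).
  rewrite IHe RintegralZl//; last exact: integrable_indic.
  by rewrite /Rintegral integral_indic// setIT.
have -> : (fun x => g (S x)) = g \o S by [].
by rewrite gE; exact: H.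
Qed.

Lemma bounded_Rintegrable {R : realType} {disp : measure_display}
    {T : measurableType disp} (P : probability T R) (f : T -> R) (M : R) :
  measurable_fun setT f -> (forall x, `|f x| <= M) ->
  P.-integrable setT (EFin \o f).
Proof.
move=> mf fM; apply: measurable_bounded_integrable => //.
  exact: le_lt_trans (probability_le1 P measurableT) (ltry 1).
by exists M; split; rewrite ?num_real// => y My x _; exact: le_trans (fM x) (ltW My).
Qed.

(** Serves to compare integrals on different spaces: if the fibres of the two maps [S] have nearly
    equal masses, both integrals are close to nearly equal finite sums. *)
Lemma Rintegral_near_finite_range {R : realType} {disp : measure_display}
    {T : measurableType disp} (P : probability T R) (I : finType)
    (S : T -> I) (f : T -> R) (h : I -> R) (e : R) :
  (forall i, measurable (S @^-1` [set i])) -> P.-integrable setT (EFin \o f) ->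
  (forall x, `|f x - h (S x)| <= e) ->
  `|\int[P]_x f x - \sum_i h i * fine (P (S @^-1` [set i]))| <= e.
Proof.
move=> mS fi fh; have [hi <-] := Rintegral_finite_range P h mS.
rewrite -RintegralB//.
have iD := integrableB measurableT fi hi.
apply: (le_trans (le_normr_Rintegral _ iD)) => //.
rewrite -[leRHS](probability_Rintegral_cst P); apply: le_Rintegral => //.
  exact: (integrable_abse iD).
exact: finite_measure_integrable_cst.
Qed.

(** * Descent along a mixture *)

Section calculus.
Context {R : realType} {d : nat} {X : set 'rV[R]_d} {X0 : X !=set0}.
Local Notation PX := (prob X0).
Implicit Types (J : PX -> R) (mu nu : PX) (x : domain X0).

Lemma mixture_TV (t : R) mu nu : 0 <= t <= 1 -> TV X0 (mixture t mu nu) mu <= t.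
Proof.
move=> t01; have /andP[t0 t1] := t01; apply: ge_sup.
  by exists `|fine (mixture t mu nu set0) - fine ((mu : probability _ R) set0)|, set0.
move=> _ [A mA <-].
have p01 (P : probability (domain X0) R) : 0 <= fine (P A) <= 1.
  by rewrite fine_ge0//= -lee_fin fineK ?probability_le1// fin_num_measure.
have := p01 mu; have := p01 nu.
rewrite /= /mixture t01 fineD ?fineM ?fin_numM ?fin_num_measure//=.
move: (fine _) (fine _) => a b /andP[a0 a1] /andP[b0 b1].
rewrite (_ : _ + _ - _ = t * (b - a)); last by ring.
by rewrite normrM ger0_norm// ler_piMr// ler_norml; apply/andP; split; lra.
Qed.

(** Convexity bounds every difference quotient with [0 < t <= 1] by the right-hand side, and the
    bound survives the limit. *)
Lemma vonMises_le J mu nu : convex_functional J -> vonMises_exists J mu ->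
  vonMises J mu nu <= J nu - J mu.
Proof.
move=> Jc [Jcvg _]; apply: limr_le; first exact: Jcvg.
near=> t.
have t0 : 0 < t by near: t; exact: nbhs_right_gt.
have t1 : t <= 1 by near: t; exact: nbhs_right_le.
rewrite /diff_quotient mulrC ler_pdivrMr//.
have := Jc mu nu t; rewrite t1 ltW// => /(_ isT).
by move: (J _) (J _) (J _) => a b c; lra.
Unshelve. all: by end_near. Qed.

(** Testing the derivative on Dirac masses identifies the influence function as [phi] minus its
    [mu]-mean [c]. *)
Lemma vonMises_influence J mu : vonMises_exists J mu ->
  (forall nu : probability (domain X0) R,
     nu.-integrable setT (EFin \o influence J mu)) /\
  forall nu, vonMises J mu nu = \int[(nu : probability _ R)]_x influence J mu x.
Proof.
move=> [Jcvg [phi [mphi iphi Jphi]]].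
pose c := \int[(mu : probability _ R)]_y phi y.
have hE : influence J mu = fun x => phi x - c.
  apply/funext => x; rewrite [LHS](Jphi \d_x).
  rewrite [X in X - _](_ : _ = phi x)//.
  rewrite /Rintegral integral_dirac//=; last exact/measurable_EFinP.
  by rewrite indicE in_setT mul1r.
have icst (nu : probability (domain X0) R) : nu.-integrable setT (EFin \o (fun=> c)).
  exact: finite_measure_integrable_cst.
split=> nu.
  rewrite hE; exact: (integrableB measurableT (iphi nu) (icst nu)).
rewrite [LHS](Jphi nu) hE RintegralB//; [|exact: iphi|exact: icst].
by congr (_ - _); rewrite probability_Rintegral_cst.
Qed.

Lemma vonMises_self J mu : vonMises_exists J mu -> vonMises J mu mu = 0.
Proof. by move=> [_ [phi [_ _ ->]]]; rewrite subrr. Qed.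

(* Convexity is used at the far end [m := mixture t mu nu] of the step, where
   [\int h_m dm = 0] turns the tangent at [m] into [t \int h_m d(nu - mu)];
   smoothness then replaces [h_m] by [h_mu] at the price of [2 L t]. *)
Lemma smooth_descent J (L : R) mu nu (t : R) : 0 <= t <= 1 -> 0 <= L ->
  (forall mu, vonMises_exists J mu) -> convex_functional J ->
  smooth_functional L J ->
  J (mixture t mu nu) <= J mu + t * vonMises J mu nu + 2 * L * t ^+ 2.
Proof.
move=> t01 L0 Jv Jc Js; have /andP[t0 t1] := t01.
pose m : PX := mixture t mu nu.
have [ih Jh] := vonMises_influence (Jv mu).
have [im Jm] := vonMises_influence (Jv m).
have := vonMises_self (Jv m); rewrite Jm /m /= (Rintegral_mixture mu nu t01 im).
rewrite -/m Jh.
have : vonMises J m mu <= J mu - J m by exact: vonMises_le.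
rewrite Jm.
have diff x : `|influence J m x - influence J mu x| <= L * t.
  rewrite -lee_fin; apply: le_trans (_ : _ <= (L * TV X0 m mu)%:E)%E _.
    by apply: le_trans (Js m mu); apply: ereal_sup_ubound; exists x.
  by rewrite lee_fin ler_wpM2l// mixture_TV.
have id (P : probability (domain X0) R) :
    `|\int[P]_x influence J m x - \int[P]_x influence J mu x| <= L * t.
  have iD : P.-integrable setT (EFin \o (fun x => influence J m x - influence J mu x)).
    exact: (integrableB measurableT (im P) (ih P)).
  rewrite -RintegralB; [|by []|exact: im|exact: ih].
  apply: (le_trans (le_normr_Rintegral _ iD)) => //.
  rewrite [leRHS](_ : _ = \int[P]_x (L * t)).
    apply: le_Rintegral => //.
      exact: (integrable_abse iD).
    exact: finite_measure_integrable_cst.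
  by rewrite probability_Rintegral_cst.
have := id nu; have := id mu.
set a := \int[mu]_x influence J m x; set b := \int[mu]_x influence J mu x.
set c := \int[nu]_x influence J m x; set e := \int[nu]_x influence J mu x.
rewrite !ler_norml => /andP[h1 h2] /andP[h3 h4] h5 h6.
have b0 : b = 0 by rewrite -[b]Jh vonMises_self.
(* [h6] says [- a = t * (c - a)], so [h5] bounds the increase of [J] by [t * (c - a)]. Replacing [c]
   by [e] and [a] by [b = 0] costs [L * t] each. *)
have : t * (c - a) <= t * (e + 2 * (L * t)) by rewrite ler_wpM2l//; lra.
by move: (J mu) (J _) h5 h6 => Jmu Jmix h5 h6; nra.
Qed.
End calculus.

(** * The deterministic recursion *)

Section rates.
Context {R : realType}.
Implicit Types (a x : R) (r e : nat -> R).

(** A lower Riemann bound for the integral of a s^(-1-a) over [x, x+1]. After division by (x+1)^(-a)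
    it follows from 1 + y <= exp y and ln(1 - i) <= -i with i = 1/(x+1). *)
Lemma powRN_telescope a x : 0 < a -> 0 < x ->
  a * (x + 1) `^ (- 1 - a) <= x `^ (- a) - (x + 1) `^ (- a).
Proof.
move=> a0 x0; have x10 : 0 < x + 1 by rewrite addr_gt0.
have xE : x = (x + 1) * (1 - (x + 1)^-1).
  by rewrite mulrBr mulr1 mulfV ?gt_eqF// addrK.
have i1 : 0 < (x + 1)^-1 by rewrite invr_gt0.
have i2 : (x + 1)^-1 < 1 by rewrite invf_lt1// ltrDr.
have q0 : 0 < 1 - (x + 1)^-1 by rewrite subr_gt0.
have -> : (x + 1) `^ (- 1 - a) = (x + 1) `^ (- a) * (x + 1)^-1.
  rewrite [- 1 - a]addrC powRD; first by rewrite powR_inv1// ltW.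
  by apply/implyP => _; rewrite gt_eqF.
have -> : x `^ (- a) = (x + 1) `^ (- a) * (1 - (x + 1)^-1) `^ (- a).
  by rewrite -powRM -?xE// ltW.
rewrite mulrCA -[X in _ <= _ - X]mulr1 -mulrBr ler_wpM2l ?powR_ge0//.
rewrite lerBrDr addrC /powR gt_eqF//.
apply: le_trans (expR_ge1Dx _); rewrite lerD2l mulNr -mulrN ler_pM2l//.
by rewrite lerNr le_ln1Dx// ltrN2.
Qed.

Lemma powRN_sum a n : 0 < a ->
  \sum_(j < n) (j%:R + 2) `^ (- 1 - a) <= a^-1.
Proof.
move=> a0; rewrite -[leRHS]mul1r ler_pdivlMr// mulrC mulr_sumr.
pose f j : R := - (j%:R + 1) `^ (- a).
apply: (@le_trans _ _ (\sum_(0 <= j < n) (f j.+1 - f j))).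
  rewrite big_mkord; apply: ler_sum => j _.
  have := @powRN_telescope a (j%:R + 1) a0.
  rewrite ltr_wpDl// => /(_ isT).
  have -> : j%:R + 1 + 1 = j%:R + 2 :> R by rewrite -addrA.
  have E : j.+1%:R + 1 = j%:R + 2 :> R by rewrite -natr1 -addrA.
  by rewrite /f E opprK [leRHS]addrC.
rewrite telescope_sumr// /f add0r powR1 opprK addrC gerDl.
by rewrite oppr_le0 powR_ge0.
Qed.

Lemma cvg_natr_powRN a : 0 < a -> (k%:R : R) `^ (- a) @[k --> \oo] --> (0 : R).
Proof.
move=> a0; apply/cvgrPdist_lt => /= eps eps0.
near=> k.
have k0 : (0 : R) < k%:R by rewrite ltr0n; near: k; exact: nbhs_infty_gt.
rewrite sub0r normrN ger0_norm ?powR_ge0// powRN.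
rewrite -[ltRHS]invrK ltf_pV2 ?posrE ?invr_gt0 ?powR_gt0//.
have -> : eps^-1 = (eps^-1 `^ a^-1) `^ a.
  by rewrite -powRrM mulVf ?gt_eqF// powRr1// invr_ge0 ltW.
apply: gt0_ltr_powR => //; rewrite ?nnegrE ?powR_ge0//.
by near: k; exact: nbhs_infty_gtr.
Unshelve. all: by end_near. Qed.

(** Since 1 - [step k] is k/(k+2), the factor (k+1)(k+2) turns the recursion into a telescoping one
    for k(k+1) r_k. This product vanishes at k = 0, so the initial gap does not enter. *)
Lemma fw_recursion_sum r e : (forall k, 0 <= r k) ->
  (forall k, r k.+1 <= (1 - step k) * r k + e k) ->
  forall k, k%:R * (k%:R + 1) * r k <=
    \sum_(j < k) (j%:R + 1) * (j%:R + 2) * e j.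
Proof.
move=> r0 re; elim=> [|k IH]; first by rewrite big_ord0 !mul0r.
rewrite big_ord_recr/=; apply: le_trans (lerD IH (lexx _)).
have -> : k.+1%:R + 1 = k%:R + 2 :> R by rewrite -natr1 -addrA.
rewrite -natr1.
have k0 : (0 : R) <= k%:R by [].
have k2 : k%:R + 2 != 0 :> R by rewrite gt_eqF// ltr_wpDl.
apply: le_trans (ler_wpM2l _ (re k)) _; first by rewrite mulr_ge0// addr_ge0.
rewrite mulrDr lerD2r le_eqVlt; apply/orP; left; apply/eqP.
by rewrite /step; field.
Qed.

(** With a = delta/2 and j < k, the weight (j+1)(j+2) is at most (k+1)^(1+a) (j+2)^(1-a). This gives
    k^2 r_k <= 4 M k^(1+a), and the unspent half of delta remains as the decaying factor k^(-a). *)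
Lemma fw_rate r e (delta M : R) : 0 < delta < 1 ->
  (forall k, 0 <= r k) -> (forall k, 0 <= e k) ->
  (forall k, r k.+1 <= (1 - step k) * r k + e k) ->
  (forall n, \sum_(j < n) (j%:R + 2) `^ (1 - delta / 2) * e j <= M) ->
  k%:R `^ (1 - delta) * r k @[k --> \oo] --> (0 : R).
Proof.
move=> /andP[d0 d1] r0 e0 re eM; set a := delta / 2 in eM *.
have a0 : 0 < a by rewrite divr_gt0.
have a1 : 0 <= 1 + a by rewrite addr_ge0// ltW.
have M0 : 0 <= M by have := eM 0%N; rewrite big_ord0.
suff bound k : (0 < k)%N ->
    k%:R `^ (1 - delta) * r k <= 4 * M * k%:R `^ (- a).
  apply: (@squeeze_cvgr _ _ _ _ (fun=> 0) (fun k => 4 * M * k%:R `^ (- a))).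
  - near=> k; rewrite mulr_ge0 ?powR_ge0//= bound//.
    by near: k; exact: nbhs_infty_gt.
  - exact: cvg_cst.
  - rewrite -(mulr0 (4 * M)); apply: cvgMr.
    exact: cvg_natr_powRN.
move=> k0; have kp : (0 : R) < k%:R by rewrite ltr0n.
have k1 : (1 : R) <= k%:R by rewrite ler1n.
have Sle : k%:R * (k%:R + 1) * r k <= (k%:R + 1) `^ (1 + a) * M.
  apply: le_trans (fw_recursion_sum r0 re k) _.
  apply: le_trans (ler_wpM2l (powR_ge0 _ _) (eM k)).
  rewrite mulr_sumr; apply: ler_sum => j _; rewrite mulrA ler_wpM2r//.
  have j2 : (0 : R) < j%:R + 2 by rewrite ltr_wpDl.
  have j1 : (0 : R) <= j%:R + 1 by rewrite addr_ge0.
  apply: (@le_trans _ _ ((j%:R + 2) `^ (1 + a) * (j%:R + 2) `^ (1 - a))).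
    rewrite -powRD; last by apply/implyP => _; rewrite gt_eqF.
    rewrite (_ : 1 + a + (1 - a) = 2%:R); last by rewrite addrACA subrr addr0.
    by rewrite powR_mulrn ?expr2 ?ler_wpM2r ?lerD2l ?ler1n// ltW.
  rewrite ler_wpM2r ?powR_ge0//.
  have jk : j%:R + 1 <= k%:R :> R by rewrite natr1 ler_nat.
  by apply: ge0_ler_powR; rewrite ?nnegrE//; lra.
have {}Sle : k%:R * (k%:R * r k) <= 4 * M * k%:R `^ (1 + a).
  apply: le_trans (_ : _ <= (k%:R + 1) `^ (1 + a) * M) _.
    apply: le_trans Sle; rewrite mulrA ler_wpM2r// ler_wpM2l ?ltW//.
    by rewrite ltrDl.
  rewrite mulrAC ler_wpM2r//.
  (* The constant 4 comes from k + 1 <= 2k and 2^(1+a) <= 4. *)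
  apply: (@le_trans _ _ ((2 * k%:R) `^ (1 + a))).
    by apply: ge0_ler_powR; rewrite ?nnegrE//; lra.
  rewrite powRM// ler_wpM2r ?powR_ge0//.
  rewrite (_ : 4 = 2 `^ 2%:R); last by rewrite powR_mulrn// -natrX.
  by rewrite ler_powR ?ler1n// /a; lra.
have kk0 : (0 : R) < k%:R * k%:R by rewrite mulr_gt0.
rewrite -(ler_pM2l kk0).
rewrite (_ : _ * (_ `^ _ * r k) = k%:R `^ (1 - delta) * (k%:R * (k%:R * r k)));
  last by ring.
apply: le_trans (ler_wpM2l (powR_ge0 _ _) Sle) _.
rewrite le_eqVlt; apply/orP; left; apply/eqP.
rewrite (_ : _ * (4 * M * _) = 4 * M * (k%:R `^ (1 - delta) * k%:R `^ (1 + a)));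
  last by ring.
rewrite (_ : _ * (4 * M * _) = 4 * M * (k%:R `^ 2%:R * k%:R `^ (- a))); last first.
  by rewrite powR_mulrn//; ring.
have kn0 : k%:R != 0 :> R by rewrite gt_eqF.
rewrite -!powRD ?kn0 ?implybT//.
have -> : 1 - delta + (1 + a) = 2%:R - a by rewrite /a; lra.
by [].
Unshelve. all: by end_near. Qed.
End rates.

(** * Weak sequential compactness of P(X) *)

Section domain_topology.
Context {R : realType} {d : nat} {X : set 'rV[R]_d} {X0 : X !=set0}.
Local Notation D := (domain X0).

Lemma domain_val_continuous : continuous (val : D -> 'rV[R]_d).
Proof. exact: (@initial_continuous (set_type X) _ set_val). Qed.

Lemma domain_nbhs (x : D) (U : set D) : nbhs x U ->
  exists2 V : set 'rV[R]_d, nbhs (val x) V & forall y : D, V (val y) -> U y.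
Proof.
move=> [W [[V oV VW] Wx WU]]; exists V.
  by apply: open_nbhs_nbhs; split => //; move: Wx; rewrite -VW.
by move=> y Vy; apply: WU; rewrite -VW.
Qed.

Lemma domain_compact : compact X -> compact [set: D].
Proof.
move=> cX F PF _.
have FX : (val @ F) X.
  apply: (@filterS _ F _ setT); last exact: filterT.
  by move=> x _; exact: (set_mem (valP (x : {x | x \in X}))).
have [p [Xp clp]] := cX _ (fmap_proper_filter _ PF) FX.
exists (exist _ p (mem_set Xp) : D); split => // A B FA /domain_nbhs[V pV VB].
have FA' : (val @ F) (val @` A).
  by apply: (@filterS _ F _ A) => // x Ax; exists x.
have [_ [[z Az <-] Vz]] := clp _ _ FA' pV.
by exists z; split => //; exact: VB.
Qed.

Lemma domain_countable_basis : compact X ->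
  exists b : nat -> set D, (forall i, open (b i)) /\
    forall x U, nbhs x U -> exists2 i, b i x & b i `<=` U.
Proof.
move=> cX.
pose T : pseudoPMetricType R := HB.pack (set_type X)
  (isPointed.Build (set_type X) (domain_point X0)).
have [B cB [oB Bbase]] := @compact_second_countable R T (domain_compact cX).
have /countable_injP[g ginj] := cB.
(* Indices that code no basis set default to the empty set, which is open. *)
pose b i : set D := xget set0 [set U | B U /\ g U = i].
have bE U : B U -> b (g U) = U.
  move=> BU; rewrite /b; case: xgetP => [V _ [BV gVU]|/(_ U)[]//].
  by apply: ginj; rewrite ?inE.
exists b; split => [i|x U xU].
  rewrite /b; case: xgetP => [V _ [BV _]|_]; [exact: oB|exact: open0].
have [V [BV Vx] VU] := Bbase x _ xU.
by exists (g V); rewrite bE.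
Qed.

(** [f] is the distance to the complement of [O]; the case [O = setT] is separate because that
    distance needs a point outside [O]. The lemma reduces measurability of maps into [domain X0] to
    that of real functions. *)
Lemma open_domain_cozero (O : set D) : open O ->
  exists2 f : D -> R, continuous f & O = [set x | 0 < f x].
Proof.
move=> oO; have [OT|/eqP/setTPn[a0 Oa0]] := pselect (O = setT).
  exists (fun=> 1); first exact: cst_continuous.
  by rewrite OT; apply/seteqP; split => // x _ /=.
pose S (x : D) := [set `|val x - val a| | a in ~` O].
pose f x := inf (S x).
have S0 x : S x !=set0 by exists `|val x - val a0|, a0.
have lS x : has_lbound (S x) by exists 0 => _ [a _ <-].
have f_le x a : ~ O a -> f x <= `|val x - val a|.
  by move=> Oa; apply: ge_inf => //; exists a.
have lip (x y : D) : f x <= `|val x - val y| + f y.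
  rewrite -lerBlDl; apply: lb_le_inf => // _ [a Oa <-].
  rewrite lerBlDl; apply: le_trans (f_le x a Oa) _.
  by rewrite (le_trans _ (ler_normD _ _))// addrA subrK.
exists f.
  move=> x; have Fx : Filter (nbhs x) := @nbhs_filter D x.
  apply/cvgrPdist_lt => /= e e0.
  have /cvgrPdist_lt/(_ e e0) := @domain_val_continuous x.
  apply: filterS => y xy.
  rewrite (le_lt_trans _ xy)// ler_norml lerBlDr lip/= andbT lerNl opprB.
  by rewrite lerBlDr distrC lip.
apply/seteqP; split => x /=.
  move=> Ox; have /domain_nbhs[V /nbhs_ballP[e/= e0 eV] VO] : nbhs x O.
    exact: open_nbhs_nbhs.
  apply: lt_le_trans e0 _; apply: lb_le_inf => // _ [a Oa <-].
  rewrite leNgt; apply/negP => xa; apply: Oa; apply/VO/eV.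
  by rewrite -ball_normE.
move=> fx; apply: contrapT => Ox.
by have := f_le x x Ox; rewrite subrr normr0 leNgt fx.
Qed.
End domain_topology.

(** * Binary codes of points and nested intervals with prescribed masses *)

Section coding.
Context {T : Type} (b : nat -> set T).

(* The latest bit comes first: extending a code is a [cons], and dropping its
   head coarsens it. *)
Fixpoint code (n : nat) (x : T) : seq bool :=
  if n is m.+1 then `[< b m x >] :: code m x else [::].

Lemma size_code n x : size (code n x) = n.
Proof. by elim: n => //= n ->. Qed.

Lemma drop_code n k x : drop k (code (k + n) x) = code n x.
Proof. by elim: k => [|k IH]; rewrite ?drop0. Qed.

End coding.

Section tree.
Context {R : realType} (p : seq bool -> R).

(* The masses [p] cut [0, 1[ into nested intervals of left end [left_end s] and
   length [p s]; [branch n u] is the word of the depth-[n] interval of [u]. *)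
Fixpoint left_end (s : seq bool) : R :=
  if s is c :: t then left_end t + (if c then p (false :: t) else 0) else 0.

Fixpoint branch (n : nat) (u : R) : seq bool :=
  if n is m.+1 then
    let t := branch m u in (left_end t + p (false :: t) <= u) :: t
  else [::].

Lemma size_branch n u : size (branch n u) = n.
Proof. by elim: n => //= n ->. Qed.

Lemma drop_branch n k u : drop k (branch (k + n) u) = branch n u.
Proof. by elim: k => [|k IH]; rewrite ?drop0. Qed.

Lemma measurable_branch n s : measurable [set u | branch n u = s].
Proof.
elim: n s => [|n IH] [|c t] /=.
- by rewrite (_ : [set _ | _] = setT)//; apply/seteqP; split.
- by rewrite (_ : [set _ | _] = set0)//; apply/seteqP; split.
- by rewrite (_ : [set _ | _] = set0)//; apply/seteqP; split.
rewrite (_ : [set _ | _] = [set u | branch n u = t] `&`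
    (fun u => left_end t + p (false :: t) <= u) @^-1` [set c]).
  apply: measurableI => //; rewrite -[X in measurable X]setTI.
  by apply: measurable_fun_ler.
by apply/seteqP; split=> u /= => [[<- <-]|[-> ->]].
Qed.

Hypothesis p0 : forall s, 0 <= p s.
Hypothesis p1 : p [::] = 1.
Hypothesis pD : forall s, p s = p (false :: s) + p (true :: s).

Lemma left_end_bounds s : 0 <= left_end s /\ left_end s + p s <= 1.
Proof.
elim: s => [|c s [IH0 IH1]] /=; first by rewrite p1; lra.
by have := p0 (false :: s); have := p0 (true :: s); have := pD s; case: c; lra.
Qed.

(** By [pD] the two children split the interval of their parent. A word of mass 0 has an empty
    interval, so no point of [0, 1[ branches through it. *)
Lemma branchP s u : 0 <= u < 1 ->
  (branch (size s) u = s) <-> (left_end s <= u < left_end s + p s).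
Proof.
move=> u01; elim: s => [|c t IH] /=; first by rewrite p1 add0r.
have := p0 (false :: t); have := p0 (true :: t); have := pD t => pt pt1 pt0.
split=> [[cE bt]|].
  move: cE; rewrite bt; move/IH: bt => /andP[h1 h2].
  by case: c => [|/negbT]; rewrite ?ltNge; lra.
move=> ut; have bt : branch (size t) u = t.
  by apply/IH; move: ut; case: (c); lra.
rewrite bt; congr (_ :: _); move: ut; case: (c); first by lra.
by move=> ut; apply/negbTE; rewrite -ltNge; lra.
Qed.

End tree.

Lemma code_inj_lt {T : Type} (b : nat -> set T) n i x y :
  code b n x = code b n y -> (i < n)%N -> b i x -> b i y.
Proof.
elim: n => // n IH [bxy cxy]; rewrite ltnS leq_eqVlt => /predU1P[->|/IH]; last exact.
by move=> /asboolT; rewrite bxy => /asboolP.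
Qed.

Section weak_compactness.
Context {R : realType} {d : nat} {X : set 'rV[R]_d} {X0 : X !=set0}.
Local Notation D := (domain X0).
Local Notation PX := (prob X0).

(** By compactness, finitely many basis sets on which [f] oscillates by at most [e] cover X. Once
    [N] exceeds their indices, points with equal codes lie in a common one. *)
Lemma code_oscillation (b : nat -> set D) (f : D -> R) (e : R) :
  compact X -> (forall i, open (b i)) ->
  (forall x U, nbhs x U -> exists2 i, b i x & b i `<=` U) ->
  continuous f -> 0 < e ->
  exists N, forall x y, code b N x = code b N y -> `|f x - f y| <= e.
Proof.
move=> cX bo bb cf e0.
pose good := [set i | forall y z, b i y -> b i z -> `|f y - f z| <= e].
have cover x : exists2 i, good i & b i x.
  have e20 : 0 < e / 2 by rewrite divr_gt0.
  have Fx : Filter (nbhs x) := @nbhs_filter D x.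
  have /cvgrPdist_lt/(_ _ e20) := cf x.
  move=> /bb[i bix bi]; exists i => // y z /bi/= fy /bi/= fz.
  rewrite -(subrK (f x) (f y)) -addrA (le_trans (ler_normD _ _))//.
  by rewrite distrC [leRHS]splitr lerD// ltW.
have := domain_compact (X0 := X0) cX; rewrite compact_cover.
move=> /(_ _ good b (fun i _ => bo i)) [x _|F Fgood Fcov].
  by have [i gi bix] := cover x; exists i.
exists (\max_(i <- finmap.enum_fset F) i).+1 => x y cxy.
have [i /= iF bix] := Fcov x I.
have gi : good i by have := Fgood i iF; rewrite inE.
apply: gi bix (code_inj_lt cxy _ bix).
by rewrite ltnS; apply: (@leq_bigmax_seq _ _ (fun=> true) id).
Qed.

(** Tychonoff on the cube of functions from [I] to [0, 1]; a basic neighbourhood of the cluster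
    point constrains finitely many coordinates. *)
Lemma cluster_pointwise (I : eqType) (q : nat -> I -> R) :
  (forall k s, 0 <= q k s <= 1) ->
  exists p : I -> R, forall (l : seq I) (e : R) (K : nat), 0 < e ->
    exists2 k, (K <= k)%N & forall s, s \in l -> `|p s - q k s| < e.
Proof.
move=> q01.
have cA := @tychonoff I (fun=> R) (fun=> `[0, 1]%classic) (fun=> @segment_compact R 0 1).
have qA : (q @ \oo) [set g | forall i, `[0, 1]%classic (g i)].
  by exists 0%N => // k _ /= s; rewrite in_itv/= q01.
have [p [_ clp]] := cA _ (fmap_proper_filter q _) qA.
exists p => l e K e0.
have FK : (q @ \oo) [set q k | k in [set k | (K <= k)%N]].
  by exists K => // k Kk /=; exists k.
pose TT : topologicalType := prod_topology (fun _ : I => (R : topologicalType)).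
have Fp : Filter (@nbhs TT TT p) := @nbhs_filter TT p.
have Np : @nbhs TT TT p [set g | forall s, s \in l -> `|p s - g s| < e].
  elim: l => [|s l IH].
    by apply: (@filterS _ _ _ setT); last exact: filterT.
  have Ns : @nbhs TT TT p [set g | `|p s - g s| < e].
    have pc := @proj_continuous I (fun=> (R : topologicalType)) s p.
    apply: (pc [set y | `|p s - y| < e]).
    apply: (@cvgr_dist_lt _ _ _ (nbhs (p s))) => //; exact: cvg_id.
  apply: filterS2 Ns IH => g gs gl t; rewrite inE => /predU1P[->//|].
  exact: gl.
have [_ [[k Kk <-] kl]] := clp _ _ FK Np.
by exists k.
Qed.
End weak_compactness.

(** The uniform law lives on the closed interval while [A] is only known on [0, 1[; the point 1 is
    absorbed as a null set. *)
Lemma uniform_prob01 {R : realType} (A : set R) (a b : R) : measurable A ->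
  0 <= a -> a <= b -> b <= 1 ->
  (forall u, 0 <= u < 1 -> A u <-> a <= u < b) ->
  uniform_prob (@ltr01 R) A = (b - a)%:E.
Proof.
move=> mA a0 ab b1 AE.
have mAI : measurable (A `&` `[0, 1]) by exact: measurableI.
rewrite /uniform_prob integral_uniform_pdf.
rewrite (eq_integral (fun=> 1%E)); last first.
  move=> u; rewrite inE /= in_itv/= /uniform_pdf => -[_ ->].
  by rewrite subr0 invr1.
rewrite integral_cst// mul1e.
have lab : lebesgue_measure (`[a, b[ : set R) = (b - a)%:E.
  rewrite lebesgue_measure_itv/= lte_fin -EFinB; case: ltP => // ba.
  by rewrite (_ : b = a) ?subrr//; apply/eqP; rewrite eq_le ab ba.
apply/eqP; rewrite eq_le; apply/andP; split.
  apply: (@le_trans _ _ (lebesgue_measure (`[a, b[ `|` [set (1 : R)]))).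
    apply: le_measure; rewrite ?inE//; first exact: measurableU.
    move=> u [Au]; rewrite /= !in_itv/= => /andP[u0 u1].
    have [u1'|] := ltP u 1; last by move=> u1'; right; apply/eqP; rewrite eq_le u1 u1'.
    by left; apply/AE => //; rewrite u0 u1'.
  apply: le_trans (measureU2 _ _ _) _ => //.
  rewrite [X in (_ + X)%E](_ : _ = 0%E); last exact: lebesgue_measure_set1.
  by rewrite adde0 -lab.
rewrite -lab; apply: le_measure; rewrite ?inE// => u /=; rewrite !in_itv/= => /andP[au ub].
by split; [apply/AE|]; rewrite ?au ?ub//; lra.
Qed.

(** * Extraction of weakly convergent subsequences *)

Section weak_sequential_compactness.
Context {R : realType} {d : nat} {X : set 'rV[R]_d} {X0 : X !=set0}.
Local Notation D := (domain X0).
Local Notation PX := (prob X0).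

Lemma open_domain_measurable (A : set D) : open A -> measurable A.
Proof. exact: sub_sigma_algebra. Qed.

Lemma continuous_domain_measurable (f : D -> R) :
  continuous f -> measurable_fun setT f.
Proof.
move=> /continuousP cf; apply: (measurability _ (RGenOpens.measurableE R)).
move=> _ [_ [x [y ->]] <-]; rewrite setTI; apply: open_domain_measurable.
by apply: cf; exact: interval_open.
Qed.

Lemma measurable_code (b : nat -> set D) n s : (forall i, open (b i)) ->
  measurable [set x | code b n x = s].
Proof.
move=> bo; elim: n s => [|n IH] [|c t] /=.
- by rewrite (_ : [set _ | _] = setT)//; apply/seteqP; split.
- by rewrite (_ : [set _ | _] = set0)//; apply/seteqP; split.
- by rewrite (_ : [set _ | _] = set0)//; apply/seteqP; split.
have mb := open_domain_measurable (bo n).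
rewrite (_ : [set _ | _] = [set x | code b n x = t] `&`
    (if c then b n else ~` b n)).
  by apply: measurableI => //; case: c => //; exact: measurableC.
apply/seteqP; split=> x /=.
  by move=> [<- <-]; split => //; case: asboolP.
by case: c => -[-> h]; congr (_ :: _); [exact/asboolT|exact/asboolF].
Qed.

Lemma prob_weak_seq_compact (mu_ : nat -> PX) : compact X ->
  exists (g : nat -> nat) (nu : PX),
    (forall n, (n <= g n)%N) /\ weak_cvg (mu_ \o g) nu.
Proof.
move=> cX; have [b [bo bb]] := domain_countable_basis (X0 := X0) cX.
pose cell (s : seq bool) := [set x : D | code b (size s) x = s].
have mcell s : measurable (cell s) by exact: measurable_code.
pose q k s := fine ((mu_ k : probability _ R) (cell s)).
have q01 k s : 0 <= q k s <= 1.
  rewrite fine_ge0//= -lee_fin fineK ?fin_num_measure//.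
  exact: probability_le1.
have q1 k : q k [::] = 1.
  rewrite /q (_ : cell [::] = setT) ?probability_setT//.
  by apply/seteqP; split.
have qD k s : q k s = q k (false :: s) + q k (true :: s).
  rewrite /q -fineD ?fin_num_measure//; congr fine.
  rewrite -measureU//.
    congr ((mu_ k : probability _ R) _); apply/seteqP; split => x /=.
      by move=> cx; rewrite /cell/= cx; case: (`[< _ >]); [right|left].
    by move=> [[_]|[_]].
  by apply/seteqP; split => // x [] /= []; rewrite /cell/= => -> _ [].
have [p pP] := cluster_pointwise q01.
(* Closed relations between finitely many masses pass from [q k] to [p]: a violation is refuted by
   an index [k] approximating within its gap, or a third of it for additivity. *)
have p0 s : 0 <= p s.
  rewrite leNgt; apply/negP => ps0.
  have ns0 : 0 < - p s by rewrite oppr_gt0.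
  have [k _ /(_ s)] := pP [:: s] _ 0%N ns0; rewrite inE eqxx.
  by have /andP[qk0 _] := q01 k s => /(_ isT); rewrite ltr_norml; lra.
have p1 : p [::] = 1.
  apply/eqP; rewrite -subr_eq0 -normr_le0 leNgt; apply/negP => e0.
  have [k _ /(_ [::])] := pP [:: [::]] _ 0%N e0.
  by rewrite inE eqxx q1 ltxx => /(_ isT).
have pD s : p s = p (false :: s) + p (true :: s).
  apply/eqP; rewrite -subr_eq0 -normr_le0 leNgt; apply/negP => e0.
  have e30 : 0 < `|p s - (p (false :: s) + p (true :: s))| / 3 by rewrite divr_gt0.
  have [k _ h] := pP [:: s; false :: s; true :: s] _ 0%N e30.
  have := h s; have := h (false :: s); have := h (true :: s).
  rewrite !inE !eqxx !orbT (qD k s) => /(_ isT) h1 /(_ isT) h2 /(_ isT) h3.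
  move: e0 h1 h2 h3; set A := p s; set B := p _; set C := p _.
  set e := `|_| => e0 h1 h2 h3.
  have : e <= `|A - (q k (false :: s) + q k (true :: s))|
      + `|B - q k (false :: s)| + `|C - q k (true :: s)|.
    rewrite /e (_ : A - (B + C) = (A - (q k (false :: s) + q k (true :: s)))
      - (B - q k (false :: s)) - (C - q k (true :: s))); last by ring.
    by rewrite (le_trans (ler_normB _ _))// lerD2r ler_normB.
  lra.
have pcell s : 0 < p s -> exists x, cell s x.
  move=> ps0; apply: contrapT => /forallNP s0.
  have [k _ /(_ s)] := pP [:: s] _ 0%N ps0; rewrite inE eqxx => /(_ isT).
  rewrite /q (_ : cell s = set0); last by apply/seteqP; split => // x /s0.
  by rewrite measure0/= subr0 ger0_norm// ltxx.
pose pt s := xget point (cell s).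
have ptE s : (exists x, cell s x) -> code b (size s) (pt s) = s.
  by move=> [x sx]; rewrite /pt; case: xgetP => [y _ //|/(_ x)].
(* Points outside [0, 1[ are sent to 0, so that every real has a branch through nonempty cells and
   [T] is defined on all of R. *)
pose clamp (u : R) := if 0 <= u < 1 then u else 0.
have clamp01 u : 0 <= clamp u < 1.
  by rewrite /clamp; case: ifPn => // _; rewrite lexx ltr01.
pose Br n (u : R) := branch p n (clamp u).
have codeBr n u : code b n (pt (Br n u)) = Br n u.
  rewrite -{1}(size_branch p n (clamp u)); apply/ptE/pcell.
  (* The interval of the branch contains [clamp u], so its mass is positive and its cell is
     inhabited. *)
  have := branchP p0 p1 pD (Br n u) (clamp01 u).
  by rewrite size_branch => -[/(_ erefl)]; lra.
have /choice[T TP] : forall u : R, exists t, cluster ((fun n => pt (Br n u)) @ \oo) t.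
  move=> u.
  have PF : ProperFilter ((fun n => pt (Br n u)) @ \oo) by exact: fmap_proper_filter.
  by have [t [_ ct]] := domain_compact (X0 := X0) cX PF filterT; exists t.
(* For m >= n the points [pt (Br m u)] all share the cell of depth n, so [f] varies there by at most
   [e], uniformly in [u]; the bound passes to the cluster point [T u]. *)
have fT (f : D -> R) (e : R) : continuous f -> 0 < e -> exists N, forall n, (N <= n)%N ->
    (forall x y, code b n x = code b n y -> `|f x - f y| <= e) /\
    forall u, `|f (T u) - f (pt (Br n u))| <= e.
  move=> cf e0; have [N NP] := code_oscillation cX bo bb cf e0.
  exists N => n Nn.
  have nP x y : code b n x = code b n y -> `|f x - f y| <= e.
    by move=> cxy; apply: NP; rewrite -!(drop_code b N (n - N)) subnK// cxy.
  split => // u; rewrite leNgt; apply/negP => fe.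
  have Tn : nbhs (T u) [set y | e < `|f y - f (pt (Br n u))|].
    have Fx : Filter (nbhs (T u)) := @nbhs_filter D (T u).
    move: fe; rewrite -subr_gt0 => fe.
    have /cvgrPdist_lt/(_ _ fe) := cf (T u).
    apply: filterS => y /=; rewrite ltrBrDr => fy.
    rewrite -(ltrD2l `|f (T u) - f y|); apply: lt_le_trans fy _.
    by rewrite (le_trans _ (ler_normD _ _))// addrA subrK.
  have Fn : ((fun n => pt (Br n u)) @ \oo) [set pt (Br m u) | m in [set m | (n <= m)%N]].
    by exists n => // m nm /=; exists m.
  have [_ [[m nm <-] /=]] := TP u _ _ Fn Tn.
  rewrite ltNge => /negP; apply; apply: nP.
  rewrite codeBr -(drop_code b n (m - n)) subnK// codeBr.
  by rewrite /Br -[in RHS](drop_branch p n (m - n)) subnK.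
have sz n u : size (Br n u) == n by rewrite size_branch.
pose S n u : n.-tuple bool := Tuple (sz n u).
have clampm : measurable_fun setT clamp.
  rewrite /clamp; apply: measurable_fun_ifT => //.
  by apply: measurable_and; [exact: measurable_fun_ler|exact: measurable_fun_ltr].
have mS n (s : n.-tuple bool) : measurable (S n @^-1` [set s]).
  rewrite (_ : _ @^-1` _ = clamp @^-1` [set v | branch p n v = s]).
    rewrite -[X in measurable X]setTI; apply: clampm => //.
    exact: measurable_branch.
  by apply/seteqP; split => u /=; [move=> <-|move=> h; exact: val_inj].
pose U : probability _ R := uniform_prob (@ltr01 R).
have mSf n (f : D -> R) : measurable_fun setT (fun u => f (pt (Br n u))).
  have [/measurable_int/measurable_EFinP + _] :=
    Rintegral_finite_range U (fun s : n.-tuple bool => f (pt s)) (mS n).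
  exact.
have mfT (f : D -> R) : continuous f -> measurable_fun setT (f \o T).
  move=> cf; apply: (measurable_fun_cvg (fun n => mSf n f)) => u _.
  apply/cvgrPdist_le => e e0; have [N NP] := fT f e cf e0.
  by exists N => // n Nn; have [_] := NP n Nn; exact.
(* [T] is a pointwise choice, but each [f \o T] is a limit of finite-range measurable functions, and
   every open set is some [f > 0]. *)
have mT : measurable_fun setT T.
  apply: (measurability (@open D)) => // _ [V oV <-].
  have [f cf ->] := open_domain_cozero oV.
  rewrite (_ : T @^-1` _ = (f \o T) @^-1` `]0, +oo[).
    by apply: mfT.
  by apply/seteqP; split => u /=; rewrite in_itv/= andbT.
have mT' : @measurable_fun _ _ (measurableTypeR R) D setT T := mT.
pose TT : {mfun measurableTypeR R >-> D} :=
  HB.pack T (isMeasurableFun.Build _ _ (measurableTypeR R) D T mT').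
pose nu : PX := distribution U TT.
have US n (s : n.-tuple bool) : fine (U (S n @^-1` [set s])) = p s.
  have [L0 L1] := left_end_bounds p0 p1 pD s; have ps0 := p0 s.
  have -> : U (S n @^-1` [set s]) = (left_end p s + p s - left_end p s)%:E.
    apply: uniform_prob01 => //; first lra.
    move=> u u01; rewrite -branchP// size_tuple /= -[u in branch _ _ u](_ : clamp u = u).
      by split => [<-|h] //; exact: val_inj.
    by rewrite /clamp u01.
  by rewrite /= addrAC subrr add0r.
(* [pickle] enumerates the words: the n-th index is accurate to 1/(n+1) on the first n of them. *)
have gP n : exists k, (n <= k)%N /\
    forall s, (pickle s < n)%N -> `|p s - q k s| < n.+1%:R^-1.
  have n0 : (0 : R) < n.+1%:R^-1 by rewrite invr_gt0.
  have [k nk kP] := pP (pmap unpickle (iota 0 n)) _ n n0.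
  exists k; split => // s sn; apply: kP; rewrite mem_pmap; apply/mapP.
  by exists (pickle s); rewrite ?mem_iota ?pickleK.
have [g gE] := choice gP.
exists g, nu; split => [n|f cf [M fM]]; first by have [] := gE n.
have qcvg s : q (g n) s @[n --> \oo] --> p s.
  apply/cvgrPdist_lt => e e0; near=> n.
  apply: (@lt_trans _ _ n.+1%:R^-1).
    by apply: (gE n).2; near: n; exact: nbhs_infty_gt.
  by near: n; exact: near_infty_natSinv_lt (PosNum e0).
have mf := continuous_domain_measurable cf.
(* Three errors of size [e / 4] add up: from each integral to its finite sum, and between the two
   sums. *)
apply/cvgrPdist_lt => e e0; have e40 : 0 < e / 4 by rewrite divr_gt0.
have [N /(_ N (leqnn _))[oscN TN]] := fT f (e / 4) cf e40.
have ifT : U.-integrable setT (EFin \o (f \o T)).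
  by apply: (@bounded_Rintegrable _ _ _ U (f \o T) M); [exact: mfT|move=> u; exact: fM].
have nuE : `|\int[(nu : probability _ R)]_x f x -
    \sum_(s : N.-tuple bool) f (pt s) * p s| <= e / 4.
  have -> : \int[(nu : probability _ R)]_x f x = \int[U]_u f (T u).
    rewrite /Rintegral; congr fine; apply: (@integral_distribution _ _ _ _ _ U TT).
      exact/measurable_EFinP.
    exact: ifT.
  under eq_bigr do rewrite -US.
  exact: (Rintegral_near_finite_range (P := U) (f := f \o T)
    (h := fun s : N.-tuple bool => f (pt s)) (mS N) ifT TN).
have muE k : `|\int[(mu_ k : probability _ R)]_x f x -
    \sum_(s : N.-tuple bool) f (pt s) * q k s| <= e / 4.
  have szc x : size (code b N x) == N by rewrite size_code.
  pose C x : N.-tuple bool := Tuple (szc x).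
  have CE (s : N.-tuple bool) : C @^-1` [set s] = cell s.
    apply/seteqP; split => x /=; rewrite /cell/= size_tuple; first by move=> <-.
    by move=> h; exact: val_inj.
  have -> : \sum_(s : N.-tuple bool) f (pt s) * q k s =
      \sum_(s : N.-tuple bool) f (pt s) * fine ((mu_ k : probability _ R) (C @^-1` [set s])).
    by apply: eq_bigr => s _; rewrite CE.
  apply: (Rintegral_near_finite_range (h := fun s : N.-tuple bool => f (pt s))).
  - by move=> s; rewrite CE.
  - exact: bounded_Rintegrable mf fM.
  - move=> x; apply: oscN; have := ptE (code b N x); rewrite size_code => ->//.
    by exists x; rewrite /cell /= size_code.
have sumcvg : (\sum_(s : N.-tuple bool) f (pt s) * q (g n) s) @[n --> \oo] -->
    (\sum_(s : N.-tuple bool) f (pt s) * p s).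
  by apply: cvg_big => [|s _]; [exact: add_continuous|apply: cvgMr; exact: qcvg].
move/cvgrPdist_lt/(_ _ e40) : sumcvg; apply: filterS => n /=.
have := muE (g n); move: nuE.
set a := \int[_]_x _; set c := \sum_s _; set a' := \int[_]_x _; set c' := \sum_s _.
rewrite !ler_norml !ltr_norml; lra.
Unshelve. all: by end_near. Qed.
End weak_sequential_compactness.

(** * Independence of the past and the fresh samples *)

Section freezing.
Context {R : realType} {dO d1 dE : measure_display} {Omega : measurableType dO}
  {T1 : measurableType d1} {E : measurableType dE} (P : probability Omega R).
Context {n : nat} (W : Omega -> T1) (Z : Omega -> n.-tuple E).
Hypotheses (mW : measurable_fun setT W) (mZ : measurable_fun setT Z).

Definition box (C : 'I_n -> set E) : set (n.-tuple E) :=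
  [set z | forall j, C j (tnth z j)].

Lemma measurable_box C : (forall j, measurable (C j)) -> measurable (box C).
Proof.
move=> mC; rewrite (_ : box C = \bigcap_(j in [set: 'I_n]) ((@tnth n E ^~ j) @^-1` C j)).
  apply: fin_bigcap_measurable => // j _; rewrite -[X in measurable X]setTI.
  exact: measurable_tnth.
by apply/seteqP; split => z /= h j => [_|]; exact: h.
Qed.

Hypothesis indep : forall (B : set T1) (C : 'I_n -> set E),
  measurable B -> (forall j, measurable (C j)) ->
  P (W @^-1` B `&` Z @^-1` box C) = (P (W @^-1` B) * P (Z @^-1` box C))%E.

(** For fixed [B], both sides are finite measures in [C] that agree on boxes, a pi-system generating
    the product sigma-algebra. *)
Lemma independent_of_tuple (B : set T1) (C : set (n.-tuple E)) :
  measurable B -> measurable C ->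
  P (W @^-1` B `&` Z @^-1` C) = (P (W @^-1` B) * P (Z @^-1` C))%E.
Proof.
move=> mB mC.
have mWB : measurable (W @^-1` B) by rewrite -[X in measurable X]setTI; exact: mW.
pose Zf : {mfun Omega >-> n.-tuple E} :=
  HB.pack Z (isMeasurableFun.Build _ _ _ _ Z mZ).
pose c : {nonneg R} := NngNum (fine_ge0 (measure_ge0 P (W @^-1` B))).
have [m1 m1E] : exists m1 : {measure set (n.-tuple E) -> \bar R},
    forall A, m1 A = P (Z @^-1` A `&` W @^-1` B).
  by unshelve eexists (pushforward (mrestr P mWB) Z).
pose m2 := mscale c (distribution P Zf).
have m2E A : m2 A = (P (W @^-1` B) * P (Z @^-1` A))%E.
  by rewrite /m2 /mscale/= fineK// fin_num_measure.
suff : m1 C = m2 C by rewrite m1E m2E setIC.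
pose G := [set box D | D in [set D | forall j, measurable (D j)]].
apply: (measure_unique G (fun=> setT)) => //.
- apply/seteqP; split.
    apply: smallest_sub; first exact: smallest_sigma_algebra.
    rewrite -bigcup_seq => _ [j _ [A mA <-]]; apply: sub_sigma_algebra.
    exists (fun i => if i == j then A else setT); first by move=> i; case: ifP.
    rewrite setTI; apply/seteqP; split => z /=; first by move=> /(_ j); rewrite eqxx.
    by move=> Az i; case: eqP => // ->.
  apply: smallest_sub; first exact: sigma_algebra_measurable.
  by move=> _ [D mD <-]; exact: measurable_box.
- move=> _ _ [D1 mD1 <-] [D2 mD2 <-]; exists (fun j => D1 j `&` D2 j).
    by move=> j; apply: measurableI; [exact: mD1|exact: mD2].
  apply/seteqP; split => z /=.
    by move=> h; split => j; have [] := h j.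
  by move=> [h1 h2] j; split; [exact: h1|exact: h2].
- move=> _; exists (fun=> setT) => //.
  by apply/seteqP; split.
- by apply/seteqP; split => // z _; exists 0%N.
- by move=> _ [D mD <-]; rewrite m1E [RHS]m2E setIC indep.
- move=> k; rewrite m1E preimage_setT setTI.
  by rewrite (le_lt_trans (probability_le1 _ _))// ltry.
Qed.

(** Stands in for conditioning on [W]: the joint law is a product, so Tonelli integrates over [Z]
    first with the value of [W] frozen. *)
Lemma integral_freeze (f : T1 * n.-tuple E -> \bar R) (c : \bar R) :
  measurable_fun setT f -> (forall z, 0 <= f z)%E ->
  (forall x, \int[P]_w f (x, Z w) <= c)%E ->
  (\int[P]_w f (W w, Z w) <= c)%E.
Proof.
move=> mf f0 fc.
pose Zf : {mfun Omega >-> n.-tuple E} :=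
  HB.pack Z (isMeasurableFun.Build _ _ _ _ Z mZ).
pose Wf : {mfun Omega >-> T1} :=
  HB.pack W (isMeasurableFun.Build _ _ _ _ W mW).
have mWZ : measurable_fun setT (fun w => (W w, Z w)) by exact: measurable_fun_pair.
pose WZ : {mfun Omega >-> (T1 * n.-tuple E)%type} :=
  HB.pack (fun w => (W w, Z w)) (isMeasurableFun.Build _ _ _ _ _ mWZ).
have -> : (\int[P]_w f (W w, Z w) = \int[distribution P WZ]_z f z)%E.
  by rewrite (ge0_integral_distribution WZ).
rewrite (eq_measure_integral (distribution P Wf \x distribution P Zf)%E); last first.
  move=> A mA _; apply/esym; apply: product_measure_unique => // B C mB mC.
  exact: independent_of_tuple.
rewrite fubini_tonelli1//.
apply: (@le_trans _ _ (\int[distribution P Wf]_x c)%E).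
  apply: ge0_le_integral => //.
  - by move=> x _; exact: integral_ge0.
  - exact: measurable_fun_fubini_tonelli_F.
  - move=> x _; rewrite /fubini_F (ge0_integral_distribution Zf)//; first exact: fc.
    exact: measurableT_comp mf (pair1_measurable x).
rewrite integral_cst// [X in (_ * X)%E](_ : _ = 1%E) ?mule1//.
exact: probability_setT.
Qed.
End freezing.

Lemma step01 {R : realType} k : 0 <= (step k : R) <= 1.
Proof.
have k2 : (0 : R) < k%:R + 2 by rewrite ltr_wpDl.
by rewrite /step ler_pdivrMr// mul1r lerDr ler0n andbT divr_ge0// ltW.
Qed.

(** * Adapted iterates and fresh samples *)

Section sampling.
Context {R : realType} {d : nat} {X : set 'rV[R]_d} {X0 : X !=set0}.
Context {dO dE : measure_display} {Omega : measurableType dO}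
  {E : measurableType dE} (P : probability Omega R).
Local Notation PX := (prob X0).
Variables (Y : Omega -> E) (m : nat -> nat).
Variables (Ys : nat -> nat -> {RV P >-> E}) (xhat : nat -> {RV P >-> domain X0}).
Local Notation past := (history m Ys xhat).

Lemma history_measurable k A : past k A -> measurable A.
Proof.
apply: smallest_sub; first exact: sigma_algebra_measurable.
move=> _ [i _ [[j _ [B mB <-]]|[B mB <-]]].
  exact: measurable_funP.
exact: measurable_funP.
Qed.

Lemma history_le k l : (k <= l)%N -> past k `<=` past l.
Proof.
move=> kl; apply: sub_sigma_algebra2 => A [i /andP[i1 ik] Ai].
by exists i => //; rewrite i1 (leq_trans ik).
Qed.

Section adapted.
Variables (mu0 : PX) (mu_ : nat -> Omega -> PX).
Hypothesis mu_init : forall w, mu_ 0%N w = mu0.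
Hypothesis mu_rec : forall k w,
  mu_ k.+1 w = mixture (step k) (mu_ k w) (\d_(xhat k.+1 w)).

(** The sigma-algebra on measures is generated by evaluations, and each evaluation of [mu_ k] obeys
    an affine recursion driven by the selected points, which belong to the history. *)
Lemma iterate_adapted k (B : set PX) : measurable B -> past k (mu_ k @^-1` B).
Proof.
(* [O k] is Omega equipped with the history up to [k] as its sigma-algebra. *)
pose G k := [set A | exists2 i, (1 <= i <= k)%N &
  (exists2 j, (j < m i)%N & generated (Ys i j) A) \/ generated (xhat i) A].
pose O k := g_sigma_algebraType (G k).
have ev l (A : set (domain X0)) : measurable A ->
    measurable_fun setT ((fun w => (mu_ l w : probability _ R) A) : O l -> \bar R).
  move=> mA; elim: l => [|l IH].
    rewrite (_ : (fun w => _) = cst ((mu0 : probability _ R) A)).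
      exact: measurable_cst.
    by apply/funext => w; rewrite mu_init.
  have IH' : measurable_fun setT ((fun w => (mu_ l w : probability _ R) A) : O l.+1 -> \bar R).
    move=> _ C mC; apply: (history_le (leqnSn l)); exact: IH.
  have mx : measurable_fun setT ((fun w => \1_A (xhat l.+1 w)) : O l.+1 -> R).
    have mxh : measurable_fun setT (xhat l.+1 : O l.+1 -> domain X0).
      move=> _ C mC; rewrite setTI; apply: sub_sigma_algebra.
      by exists l.+1; rewrite ?ltnS ?leqnn//; right; exists C => //; rewrite setTI.
    by apply: (measurableT_comp _ mxh); exact: measurable_indic.
  rewrite (_ : (fun w => _) = (fun w => (1 - step l)%:E * (mu_ l w : probability _ R) A
      + (step l)%:E * (\1_A (xhat l.+1 w))%:E)%E).
    apply: emeasurable_funD; apply: measurable_funeM => //.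
    exact/measurable_EFinP.
  by apply/funext => w; rewrite mu_rec /= /mixture step01.
move=> mB.
suff : measurable_fun setT (mu_ k : O k -> PX).
  by move=> /(_ measurableT B mB); rewrite setTI.
apply: (measurability (@pset _ _ _ : set (set PX))) => //.
move=> _ [_ [r _ [A mA <-]] <-]; rewrite setTI.
have := ev k A mA measurableT _ (emeasurable_itv `]-oo, r%:E[).
rewrite setTI (_ : _ @^-1` _ = mu_ k @^-1` mset A r)//.
Qed.

Lemma measurable_iterate k : measurable_fun setT (mu_ k).
Proof.
move=> _ B mB; rewrite setTI; apply: (@history_measurable k).
exact: iterate_adapted.
Qed.

Hypothesis Ys_fresh : fresh_samples P m Y Ys xhat.

Lemma fresh_iid k : iid_copies P Y (fun j : 'I_(m k.+1) => Ys k.+1 j).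
Proof.
have [Ycopy Yind] := Ys_fresh k; split => //.
move=> K A KA; have := Yind (Some @: K) (fun o => if o is Some j then A j else setT).
rewrite big_imset/=; last by move=> i j _ _ [].
move=> <-; last by move=> _ /imsetP[j jK ->]; exact: KA.
congr (P _); apply/seteqP; split => w /= h.
  by move=> _ /imsetP[j jK ->]; exact: h.
by move=> j jK; have := h (Some j); apply; exact: imset_f.
Qed.

Lemma fresh_tuple k : measurable_fun setT (fun w => [tuple Ys k.+1 j w | j < m k.+1]).
Proof.
apply/measurable_fun_tnthP => i.
rewrite (_ : _ \o _ = Ys k.+1 i); first exact: measurable_funPT.
by apply/funext => w /=; rewrite tnth_mktuple.
Qed.

Lemma integral_fresh k (f : PX * (m k.+1).-tuple E -> \bar R) (c : \bar R) :
  measurable_fun setT f -> (forall z, 0 <= f z)%E ->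
  (forall mu, \int[P]_w f (mu, [tuple Ys k.+1 j w | j < m k.+1]) <= c)%E ->
  (\int[P]_w f (mu_ k w, [tuple Ys k.+1 j w | j < m k.+1]) <= c)%E.
Proof.
move=> mf f0 fc.
apply: (integral_freeze (@measurable_iterate k) (@fresh_tuple k) _ mf f0 fc).
move=> B C mB mC; have [_ Yind] := Ys_fresh k.
pose A (o : option 'I_(m k.+1)) := if o is Some j then Ys k.+1 j @^-1` C j
  else mu_ k @^-1` B.
have FA o : past_or_fresh Ys xhat o (A o).
  case: o => [j|] /=; last exact: iterate_adapted.
  by exists (C j) => //; rewrite setTI.
pose fresh : {set option 'I_(m k.+1)} := [set~ None]%SET.
have boxE : (fun w => [tuple Ys k.+1 j w | j < m k.+1]) @^-1` box C =
    \bigcap_(o in [set` fresh]) A o.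
  apply/seteqP; split => w /= h.
    move=> [j _|]; last by rewrite /= setC11.
    by have := h j; rewrite tnth_mktuple.
  by move=> j; have := h (Some j); rewrite /= tnth_mktuple in_setC1; exact.
have allE : mu_ k @^-1` B `&` (fun w => [tuple Ys k.+1 j w | j < m k.+1]) @^-1` box C =
    \bigcap_(o in [set` [set: option 'I_(m k.+1)]%SET]) A o.
  rewrite boxE; apply/seteqP; split => w /=.
    by move=> [h1 h2] [j|] _ //; apply: h2; rewrite /= in_setC1.
  move=> h; split; first by apply: (h None); rewrite /= inE.
  by move=> o _; apply: h; rewrite /= inE.
(* Independence is used twice, with all indices and with [None] left out; the quotient of the two
   products is the factor of the past. *)
rewrite allE boxE (Yind fresh A (fun o _ => FA o)).
rewrite (Yind [set: option _]%SET A (fun o _ => FA o)) (bigD1 None) ?inE//=.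
by congr (_ * _)%E; apply: eq_bigl => o; rewrite !inE.
Qed.
End adapted.
End sampling.

(** * Stochastic Frank-Wolfe *)

Section frank_wolfe_step.
Context {R : realType} {d : nat} {X : set 'rV[R]_d} {X0 : X !=set0}.
Context {dE : measure_display} {E : measurableType dE}.
Local Notation PX := (prob X0).
Variables (J : PX -> R) (H : PX -> domain X0 -> E -> R).

Lemma minimizer_inf mustar : is_minimizer J mustar -> inf (range J) = J mustar.
Proof.
move=> Jmin; apply/eqP; rewrite eq_le; apply/andP; split.
  by apply: ge_inf; [exists (J mustar) => _ [nu _ <-]|exists mustar].
by apply: lb_le_inf; [exists (J mustar), mustar|move=> _ [nu _ <-]].
Qed.

Lemma oracle_error_ge0 n z : (0 <= oracle_error H J (m := n) z)%E.
Proof.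
apply: le_trans (_ : 0%E <= (`|oracle_mean H z.1 z.2 point -
  influence J z.1 point|)%:E)%E _; first by rewrite lee_fin.
by apply: ereal_sup_ubound; exists point.
Qed.

(** Exchanging the oracle for the influence function at [x] and at [x'] costs one error each.
    Finiteness matters because [fine] sends an infinite error to 0. *)
Lemma oracle_argmin n (y : n.-tuple E) mu x :
  oracle_error H J (mu, y) \is a fin_num ->
  (forall x', oracle_mean H mu y x <= oracle_mean H mu y x') ->
  forall x', influence J mu x <=
    influence J mu x' + 2 * fine (oracle_error H J (mu, y)).
Proof.
move=> fin xmin x'.
have err z : `|oracle_mean H mu y z - influence J mu z| <=
    fine (oracle_error H J (mu, y)).
  by rewrite -lee_fin fineK//; apply: ereal_sup_ubound; exists z.
have := err x; have := err x'; have := xmin x'; rewrite !ler_norml; lra.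
Qed.

(** Averaging the near-minimality of [x] against a minimizer of [J] and using convexity gives
    h_mu(x) - 2e <= J^* - J(mu), which is inserted in the descent inequality. *)
Lemma fw_step mu x (L t e : R) : 0 <= t <= 1 -> 0 <= L ->
  (forall mu, vonMises_exists J mu) -> convex_functional J ->
  smooth_functional L J -> (exists mustar, is_minimizer J mustar) ->
  (forall x', influence J mu x <= influence J mu x' + 2 * e) ->
  J (mixture t mu \d_x) - inf (range J) <=
  (1 - t) * (J mu - inf (range J)) + (2 * t * e + 2 * L * t ^+ 2).
Proof.
move=> t01 L0 Jv Jc Js [ms Jmin] xmin; have /andP[t0 t1] := t01.
rewrite (minimizer_inf Jmin).
have := smooth_descent mu \d_x t01 L0 Jv Jc Js.
have [ih Jh] := vonMises_influence (Jv mu).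
have : influence J mu x - 2 * e <= J ms - J mu.
  apply: le_trans (vonMises_le ms Jc (Jv mu)); rewrite Jh.
  rewrite -[leLHS](probability_Rintegral_cst (ms : probability _ R)).
  apply: le_Rintegral => //; [exact: finite_measure_integrable_cst|exact: ih|].
  by move=> y _; rewrite lerBlDr.
rewrite -[vonMises J mu \d_x]/(influence J mu x).
move: (influence J mu x) (J _) (J _) (J _) => h a b c h1 h2.
have : t * (h - 2 * e) <= t * (c - b) by rewrite ler_wpM2l.
lra.
Qed.

(** The limit of an extracted subsequence is not shown to minimize [J]; as a weak limit of a
    minimizing sequence it lies in [weak_arginf J], which suffices. *)
Lemma weak_cvg_minimizing (mustar : PX) (nu_ : nat -> PX) : compact X ->
  weak_arginf J = [set mustar] ->
  J (nu_ n) @[n --> \oo] --> inf (range J) -> weak_cvg nu_ mustar.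
Proof.
move=> cX Jarg Jnu f cf fM.
apply/cvgrPdist_lt => e e0; apply: contrapT => far.
pose bad n := e <= `|\int[(mustar : probability _ R)]_x f x -
  \int[(nu_ n : probability _ R)]_x f x|.
have /choice[h hP] : forall n, exists k, (n <= k)%N /\ bad k.
  move=> n; apply: contrapT => none; apply: far.
  exists n => // k nk; rewrite /= ltNge; apply/negP => bk.
  by apply: none; exists k.
have [g [nu [gn nucvg]]] := prob_weak_seq_compact (nu_ \o h) cX.
have nuE : nu = mustar.
  suff : weak_arginf J nu by rewrite Jarg.
  exists (nu_ \o h \o g) => //=.
  apply: (cvg_comp (h \o g) (J \o nu_) _ Jnu) => A [N _ NA].
  exists N => // n /= Nn; apply: NA => /=.
  by rewrite (leq_trans Nn)// (leq_trans (gn n))//; have [] := hP (g n).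
have /cvgrPdist_lt/(_ e e0) := nucvg f cf fM.
move=> [N _ /(_ N)] /=; rewrite leqnn nuE => /(_ isT).
by rewrite ltNge => /negP; apply; have [_] := hP (g N).
Qed.
End frank_wolfe_step.

(** * Almost sure rates from bounds on expected errors *)

Section almost_sure_rate.
Context {R : realType} {dO : measure_display} {Omega : measurableType dO}.
Variable P : probability Omega R.

Lemma ae_fw_rate (r : nat -> Omega -> R) (err : nat -> Omega -> \bar R)
    (C B delta : R) : 0 < delta < 1 -> 0 <= C -> 0 <= B ->
  (forall k w, 0 <= r k w) ->
  (forall k, measurable_fun setT (err k)) -> (forall k w, 0 <= err k w)%E ->
  (forall k, \int[P]_w err k w <= (C / (k%:R + 2))%:E)%E ->
  (forall k w, err k w \is a fin_num -> r k.+1 w <=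
     (1 - step k) * r k w + (2 * step k * fine (err k w) + B * step k ^+ 2)) ->
  {ae P, forall w, k%:R `^ (1 - delta) * r k w @[k --> \oo] --> (0 : R)}.
Proof.
move=> d01 C0 B0 r0 merr err0 Eerr rec; set a := delta / 2.
have a0 : 0 < a by rewrite divr_gt0//; case/andP: d01.
have j2 j : (0 : R) < j%:R + 2 by rewrite ltr_wpDl.
pose c j : R := (j%:R + 2) `^ (1 - a) * (2 * step j).
have c0 j : 0 < c j by rewrite !mulr_gt0 ?powR_gt0// /step divr_gt0.
have weight j : (j%:R + 2) `^ (1 - a) / (j%:R + 2) ^+ 2 =
    (j%:R + 2) `^ (- 1 - a) :> R.
  rewrite -powR_mulrn ?ltW// -powRN -powRD; last first.
    by apply/implyP => _; rewrite gt_eqF.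
  by congr (_ `^ _); lra.
pose S w := (\sum_(0 <= j <oo) (c j)%:E * err j w)%E.
have mce j : measurable_fun setT (fun w => (c j)%:E * err j w)%E.
  exact: measurable_funeM.
have ce0 j w : (0 <= (c j)%:E * err j w)%E by rewrite mule_ge0// lee_fin ltW.
have ES : (\int[P]_w S w <= (4 * C * a^-1)%:E)%E.
  rewrite integral_nneseries//; apply: lime_le.
    by apply: is_cvg_nneseries => n _ _; exact: integral_ge0.
  apply: nearW => n; rewrite big_mkord.
  (* One factor 2 of the 4 comes from [c j] and the other from [step j = 2 / (j + 2)]. *)
  apply: (@le_trans _ _ (\sum_(j < n) (4 * C * (j%:R + 2) `^ (- 1 - a))%:E)%E).
    apply: lee_sum => j _; rewrite ge0_integralZl//; last by rewrite lee_fin ltW.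
    apply: (le_trans (lee_wpmul2l _ (Eerr j))); first by rewrite lee_fin ltW.
    rewrite -EFinM lee_fin -weight /c /step le_eqVlt; apply/orP; left; apply/eqP.
    by field; rewrite gt_eqF.
  rewrite sumEFin lee_fin -mulr_sumr ler_wpM2l ?mulr_ge0//.
  exact: powRN_sum.
have mS : measurable_fun setT S by apply: ge0_emeasurable_sum => // k w _ _; exact: ce0.
have S0 w : (0 <= S w)%E by apply: nneseries_ge0.
have iS : P.-integrable setT S.
  apply/integrableP; split => //.
  under eq_integral do rewrite gee0_abs//.
  exact: le_lt_trans ES (ltry _).
have aeS := integrable_ae measurableT iS.
apply: filterS aeS => w /(_ I) Sfin.
have cS n : (\sum_(j < n) (c j)%:E * err j w <= S w)%E.
  rewrite -(big_mkord predT (fun j => (c j)%:E * err j w)%E).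
  exact: nneseries_lim_ge.
(* A finite sum with positive weights has finite terms, so the recursion holds at every step on the
   same almost sure event. *)
have errfin j : err j w \is a fin_num.
  rewrite ge0_fin_numE//; have := cS j.+1; rewrite big_ord_recr/=.
  move=> /(le_trans (leeDr _ _)); rewrite sume_ge0// => /(_ isT) h.
  have : ((c j)%:E * err j w < +oo)%E.
    by apply: le_lt_trans h _; rewrite -ge0_fin_numE.
  by apply: contraTT; rewrite -leNgt leye_eq => /eqP ->; rewrite gt0_muley ?lte_fin// ltxx.
(* The bound may depend on [w]: [S w] controls the sampling errors and 4B/a the quadratic terms. *)
apply: (@fw_rate _ _ (fun k => 2 * step k * fine (err k w) + B * step k ^+ 2)
  delta (fine (S w) + 4 * B * a^-1)) => //.
- move=> k; have s0 : 0 <= step k :> R by rewrite /step divr_ge0// ltW.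
  by rewrite addr_ge0 ?mulr_ge0 ?fine_ge0 ?exprn_ge0.
- by move=> k; exact: rec.
move=> n; under eq_bigr do rewrite mulrDr; rewrite big_split/=; apply: lerD.
  rewrite -lee_fin fineK//; apply: le_trans (cS n).
  rewrite -sumEFin; apply: lee_sum => j _.
  by rewrite -[in leRHS](fineK (errfin j)) -EFinM lee_fin /c mulrA.
apply: (@le_trans _ _ (4 * B * \sum_(j < n) (j%:R + 2) `^ (- 1 - a))).
  rewrite mulr_sumr; apply: ler_sum => j _.
  rewrite -weight /step le_eqVlt; apply/orP; left; apply/eqP.
  by field; rewrite gt_eqF.
by rewrite ler_wpM2l ?mulr_ge0// powRN_sum.
Qed.
End almost_sure_rate.

Unset Implicit Arguments.

Theorem theorem3 (R : realType) (d : nat) (X : set 'rV[R]_d)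
  (X0 : X !=set0) (Xcompact : compact X)
  (J : prob X0 -> R) (L : R)
  (J_vonMises : forall mu, vonMises_exists J mu)
  (J_convex : convex_functional J)
  (L_gt0 : 0 < L) (J_smooth : smooth_functional L J)
  (J_attained : exists mu, is_minimizer J mu)
  (diam_gt0 : 0 < TV_diameter X0)
  (dispO : measure_display) (Omega : measurableType dispO)
  (P : probability Omega R)
  (dispE : measure_display) (E : measurableType dispE)
  (Y : {RV P >-> E})
  (H : prob X0 -> domain X0 -> E -> R)
  (H_measurable : forall mu x, measurable_fun setT (H mu x))
  (H_unbiased : forall mu x,
     ('E_P[fun w => H mu x (Y w)] = (influence J mu x)%:E)%E)
  (error_measurable : forall m, measurable_fun setT 
     (@oracle_error R d X X0 dispE E H J m))
  (c0 : R) (H_rate : oracle_rate H P J Y c0)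
  (m : nat -> nat)
  (m_gt0 : forall k, (1 <= k)%N -> (0 < m k)%N)
  (m_large : forall k, (1 <= k)%N ->
     (c0 * (k%:R + 2) / (L * TV_diameter X0)) ^+ 2 <= (m k)%:R)
  (Ys : nat -> nat -> {RV P >-> E})
  (xhat : nat -> {RV P >-> domain X0})
  (Ys_fresh : fresh_samples P m Y Ys xhat)
  (mu0 : prob X0) (mu_ : nat -> Omega -> prob X0)
  (mu_init : forall w, mu_ 0%N w = mu0)
  (xhat_argmin : forall k w x,
     let y := [tuple Ys k.+1 j w | j < m k.+1] in
     oracle_mean H (mu_ k w) y (xhat k.+1 w) <= oracle_mean H (mu_ k w) y x)
  (mu_rec : forall k w,
     mu_ k.+1 w = mixture (step k) (mu_ k w) (\d_(xhat k.+1 w))) :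
  (forall delta : R, 0 < delta < 1 ->
     {ae P, forall w,
        (k%:R `^ (1 - delta) * (J (mu_ k w) - inf (range J)))
          @[k --> \oo] --> (0 : R)})
  /\
  (forall mustar : prob X0,
     is_minimizer J mustar -> weak_arginf J = [set mustar] ->
     {ae P, forall w, weak_cvg (fun k => mu_ k w) mustar}).
Proof.
set D := TV_diameter X0 in diam_gt0 m_large *.
have LD : 0 < L * D by rewrite mulr_gt0.
have Jv := J_vonMises; have L0 := ltW L_gt0.
pose r k w := J (mu_ k w) - inf (range J).
pose err k w := oracle_error H J (mu_ k w, [tuple Ys k.+1 j w | j < m k.+1]).
have [ms msmin] := J_attained.
have r0 k w : 0 <= r k w by rewrite /r (minimizer_inf msmin) subr_ge0.
have merr k : measurable_fun setT (err k).
  apply: (measurableT_comp (error_measurable _)); apply: measurable_fun_pair.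
    exact: (measurable_iterate m Ys mu_init mu_rec).
  exact: (fresh_tuple Ys).
have err0 k w : (0 <= err k w)%E by exact: oracle_error_ge0.
have Eerr k : (\int[P]_w err k w <= (L * D / (k%:R + 2))%:E)%E.
  have mk := m_gt0 k.+1 isT; set s := Num.sqrt ((m k.+1)%:R : R).
  have s0 : 0 < s by rewrite sqrtr_gt0 ltr0n.
  have rate mu : (\int[P]_w (s%:E * oracle_error H J
      (mu, [tuple Ys k.+1 j w | j < m k.+1])) <= c0%:E)%E.
    exact: (H_rate mu (m k.+1) _ mk (fresh_iid Ys_fresh k)).
  have sE : (s%:E * \int[P]_w err k w <= c0%:E)%E.
    rewrite -ge0_integralZl//; last by rewrite lee_fin ltW.
    (* The oracle bound is for a deterministic measure; independence of the fresh samples transfers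
       it to the random [mu_ k]. *)
    apply: (integral_fresh mu_init mu_rec Ys_fresh
      (f := fun z => s%:E * oracle_error H J z)%E) => //.
      by apply: measurable_funeM; exact: error_measurable.
    by move=> z; rewrite mule_ge0 ?oracle_error_ge0// lee_fin ltW.
  have c00 : 0 <= c0.
    by rewrite -lee_fin (le_trans _ sE)// mule_ge0 ?integral_ge0// lee_fin ltW.
  have k3 : (0 : R) < k.+1%:R + 2 by rewrite ltr_wpDl.
  (* The sample size of index [k.+1] gives the denominator k + 3, weakened here to k + 2. *)
  have cs : c0 <= s * (L * D / (k%:R + 2)).
    apply: (@le_trans _ _ (s * (L * D / (k.+1%:R + 2)))); last first.
      rewrite ler_wpM2l ?(ltW s0)// ler_wpM2l ?(ltW LD)//.
      by rewrite lef_pV2 ?posrE ?ltr_wpDl// lerD2r ler_nat.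
    have q0 : 0 <= c0 * (k.+1%:R + 2) / (L * D).
      by rewrite divr_ge0 ?(ltW LD)// mulr_ge0 ?(ltW k3).
    have : c0 * (k.+1%:R + 2) / (L * D) <= s.
      by rewrite -(ger0_norm q0) -sqrtr_sqr ler_wsqrtr// m_large.
    by rewrite ler_pdivrMr// => h; rewrite [leRHS]mulrA ler_pdivlMr.
  rewrite -(@lee_pmul2l _ s%:E)//.
  by apply: le_trans sE _; rewrite -EFinM lee_fin.
have rec k w : err k w \is a fin_num -> r k.+1 w <=
    (1 - step k) * r k w + (2 * step k * fine (err k w) + 2 * L * step k ^+ 2).
  move=> fin; rewrite /r mu_rec; apply: fw_step => //; first exact: step01.
  by apply: (oracle_argmin fin) => x'; exact: xhat_argmin.
have rate delta : 0 < delta < 1 ->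
    {ae P, forall w, (k%:R `^ (1 - delta) * r k w) @[k --> \oo] --> (0 : R)}.
  move=> d01; apply: (ae_fw_rate d01 (ltW LD) _ r0 merr err0 Eerr rec).
  by rewrite mulr_ge0.
split => // mustar _ Jarg.
(* Any exponent would do: for k >= 1 the factor k^(1/2) is at least 1, so the gap itself tends to
   0. *)
have := rate 2^-1; rewrite invr_gt0 ltr0n invf_lt1// ltr1n => /(_ isT).
apply: filterS => w rw; apply: (weak_cvg_minimizing Xcompact Jarg).
suff : r k w @[k --> \oo] --> (0 : R).
  move=> /(cvgD (cvg_cst (inf (range J)))); rewrite addr0.
  by apply: cvg_trans; apply: near_eq_cvg; near=> k; rewrite /r /= addrC subrK.
apply: (squeeze_cvgr _ (cvg_cst 0) rw); near=> k.
rewrite r0 /= ler_peMl// -[leLHS](powRr0 k%:R) ler_powR ?ler1n//.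
  by near: k; exact: nbhs_infty_gt.
by lra.
Unshelve. all: by end_near. Qed.
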